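(* Let $\Pi\neq\emptyset$ be an arbitrary index set. For every $\pi\in\Pi$, let $(\Omega_\pi,\mathcal{F}_\pi,\mathbb{P}_\pi)$ be a probability space and let $\xi_{1,\pi},\xi_{2,\pi},\ldots$ be a sequence of (real-valued) random variables on $(\Omega_\pi,\mathcal{F}_\pi,\mathbb{P}_\pi)$ being identically distributed and strongly mixing with mixing coefficients $(\alpha_\pi(n))_{n\in\mathbb{N}}$. Suppose that the following two conditions hold: $$\lim_{K\to\infty}\ \sup_{\pi\in\Pi}\ \mathbb{E}_\pi\bigl[|\xi_{1,\pi}|\mathbf{1}_{\{|\xi_{1,\pi}|\ge K\}}\bigr]=0,\qquad \lim_{n\to\infty}\ \sup_{\pi\in\Pi}\ \alpha_\pi(n)=0.$$ Then, for every $\delta>0$, $$\lim_{n\to\infty}\ \sup_{\pi\in\Pi}\ \mathbb{P}_\pi\Bigl[\Bigl|\frac1n\sum_{i=1}^n\xi_{i,\pi}-\mathbb{E}_\pi[\xi_{1,\pi}]\Bigr|\ge\delta\Bigr]=0.$$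
   Context: $\mathbb{E}_\pi$ denotes expectation under $\mathbb{P}_\pi$. For a sequence $(\xi_i)_{i\in\mathbb{N}}$ of random variables on a probability space with measure $\mathbb{P}$, the $n$th strong mixing coefficient is $\alpha_{\mathbb{P}}(n):=\sup_{k\ge1}\sup_{A,B}|\mathbb{P}[A\cap B]-\mathbb{P}[A]\mathbb{P}[B]|$, where the inner supremum ranges over all $A\in\sigma(\xi_1,\ldots,\xi_k)$ and $B\in\sigma(\xi_{k+n},\xi_{k+n+1},\ldots)$. The sequence is strongly mixing if $\alpha_{\mathbb{P}}(n)\to0$ as $n\to\infty$. Here $\alpha_\pi(n)$ is the $n$th strong mixing coefficient of $(\xi_{i,\pi})_{i\in\mathbb{N}}$ under $\mathbb{P}_\pi$. *)

(* Defs.v *)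
From HB Require Import structures.
From mathcomp Require Import all_boot all_order all_algebra.
From mathcomp Require Import all_classical all_reals all_analysis.

Set Implicit Arguments.
Unset Strict Implicit.
Unset Printing Implicit Defensive.

Import Order.TTheory GRing.Theory Num.Theory.
Import numFieldNormedType.Exports.

Local Open Scope classical_set_scope.
Local Open Scope ring_scope.
Local Open Scope ereal_scope.

(* Sequences xi_1, xi_2, ... are indexed from 0: xi_i of the text is X (i - 1). *)

Definition sigma_gen d (T : measurableType d) (R : realType)
    (P : probability T R) (X : nat -> {RV P >-> R}) (I : set nat) :
    set (set T) :=
  <<s \bigcup_(i in I) preimage_set_system setT (X i) measurable >>.

(* The laws are compared on Borel sets only: a measure is a function on all
   subsets, whose values outside the sigma-algebra are irrelevant. *)
Definition identically_distributed d (T : measurableType d) (R : realType)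
    (P : probability T R) (X : nat -> {RV P >-> R}) : Prop :=
  forall (i : nat) (B : set R), measurable B ->
    distribution P (X i) B = distribution P (X 0%N) B.

(* With the shifted indices, and k.+1 in the role of the index k >= 1 of the
   outer supremum, sigma(xi_1, ..., xi_(k.+1)) is generated by the X i with
   i <= k and sigma(xi_(k.+1 + n), ...) by the X i with k + n <= i. *)
Definition strong_mixing_coef d (T : measurableType d) (R : realType)
    (P : probability T R) (X : nat -> {RV P >-> R}) (n : nat) : \bar R :=
  ereal_sup [set ereal_sup
    [set `| P (AB.1 `&` AB.2) - P AB.1 * P AB.2 | | AB in
        sigma_gen X [set i | (i <= k)%N] `*`
        sigma_gen X [set i | (k + n <= i)%N] ] | k in [set: nat]].

Definition strongly_mixing d (T : measurableType d) (R : realType)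
    (P : probability T R) (X : nat -> {RV P >-> R}) : Prop :=
  strong_mixing_coef X n @[n --> \oo] --> 0.

(* Main.v *)
(* Truncating at level N e and rounding down to multiples of e writes each
   xi_i, up to an error e + 2 |xi_i| 1_{|xi_i| >= N e}, as the constant - N e
   plus e times a sum of 2 N indicators 1_{xi_i >= c_j}.  By uniform
   integrability the error is small in L^1 uniformly in pi.  For a single
   indicator, Cov(1_{A_i}, 1_{A_k}) <= alpha(|i - k|), so the variance of the
   empirical frequency over n terms is at most eps + (2 m + 1) / n once
   alpha <= eps beyond lag m; this bound does not depend on pi either.  Hence
   the means converge in L^1 uniformly in pi, and Markov's inequality
   concludes. *)
Require Import Defs.
From HB Require Import structures.
From mathcomp Require Import all_boot all_order all_algebra.
From mathcomp Require Import all_classical all_reals all_analysis.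
From mathcomp Require Import measurable_realfun ring lra zify.

Set Implicit Arguments.
Unset Strict Implicit.
Unset Printing Implicit Defensive.

Import Order.TTheory GRing.Theory Num.Theory.
Import numFieldNormedType.Exports.

Local Open Scope classical_set_scope.
Local Open Scope ring_scope.

(** * Rounding a real number by layers *)

(** With y = x + N e, the j-th indicator tests (j + 1) e <= y, so the sum is y rounded down to a
    multiple of e and clamped to [0, 2 N e]. Inside this range the error is at most e; outside it,
    |x| >= N e and the error is at most |x|. *)
Lemma sum_layers_error {R : realFieldType} (e x : R) (N : nat) : 0 < e ->
  `|x - (\sum_(j < N.*2) e * (j.+1%:R * e - N%:R * e <= x)%R%:R - N%:R * e)|
    <= e + 2 * (`|x| * (N%:R * e <= `|x|)%R%:R).
Proof.
move=> e0.
(* The number of layers is freed from N for the induction; the three clauses describe saturation,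
   vanishing, and rounding in between. *)
have layers M :
    let s := (\sum_(j < M) e * (j.+1%:R * e - N%:R * e <= x)%R%:R) in
    let y := (x + N%:R * e) in
    [/\ (M%:R * e <= y -> s = M%:R * e), (y < 0 -> s = 0) &
        (0 <= y < M%:R * e -> s <= y <= s + e)].
  elim: M => [|M] /=.
    rewrite big_ord0 mul0r; split=> //.
    by move=> /andP[y0 /(le_lt_trans y0)]; rewrite ltxx.
  rewrite big_ord_recr/=; set s := (\sum_(j < M) _) => -[h1 h2 h3].
  have [Mx|xM] := leP (M.+1%:R * e - N%:R * e) x.
  - have hM : (M.+1%:R * e <= x + N%:R * e) by lra.
    have M0 : (0 <= M.+1%:R * e :> R) by rewrite mulr_ge0// ltW.
    split; [move=> _|move=> ?; lra|move=> /andP[? ?]; lra].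
    rewrite h1 ?mulr1; first by rewrite -natr1 mulrDl mul1r.
    by rewrite -natr1 in hM; lra.
  - rewrite mulr0 addr0; split=> //; first by move=> ?; lra.
    move=> /andP[y0 yM]; have [yM'|yM'] := ltP (x + N%:R * e) (M%:R * e).
      by apply: h3; rewrite y0.
    by rewrite h1// yM'/=; rewrite -natr1 in yM; lra.
have := layers N.*2; rewrite /=.
set s := (\sum_(j < _) _) => -[h1 h2 h3].
have NN : ((N.*2)%:R = N%:R + N%:R :> R) by rewrite -addnn natrD.
have N0 : (0 <= N%:R * e) by rewrite mulr_ge0// ltW.
rewrite {}NN mulrDl in h1 h3.
set K := (N%:R * e) in h1 h2 h3 N0 *.
have [x0|x0] := ltP (x + K) 0.
  rewrite (h2 x0) (ltr0_norm (_ : (x < 0))); last by lra.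
  have -> : (K <= - x) by lra.
  rewrite mulr1 ler_norml; apply/andP; split; lra.
have [xK|xK] := leP (K + K) (x + K).
  rewrite (h1 xK) (ger0_norm (_ : (0 <= x))); last by lra.
  have -> : (K <= x) by lra.
  rewrite mulr1 ler_norml; apply/andP; split; lra.
have /andP[h4 h5] := h3 (introT andP (conj x0 xK)).
apply: (@le_trans _ _ e); first by rewrite ler_norml; apply/andP; split; lra.
by rewrite lerDl mulr_ge0// mulr_ge0.
Qed.

(** * Real-valued integrals and the variance of an empirical frequency *)

Section integrals.
Context d (T : measurableType d) (R : realType).

Lemma Rintegral_sum (mu : {measure set T -> \bar R}) (I : Type) (s : seq I)
    (f : I -> T -> R) : (forall i, mu.-integrable setT (EFin \o f i)) ->
  \int[mu]_w (\sum_(i <- s) f i w) = \sum_(i <- s) \int[mu]_w f i w.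
Proof.
move=> fi; rewrite /Rintegral; under eq_integral do rewrite -sumEFin.
rewrite integral_sum// sum_fine// => i _.
by apply: integrable_fin_num => //; exact: fi.
Qed.

Lemma integrable_sum_EFin (mu : {measure set T -> \bar R}) (I : Type)
    (s : seq I) (f : I -> T -> R) :
  (forall i, mu.-integrable setT (EFin \o f i)) ->
  mu.-integrable setT (EFin \o (fun w => \sum_(i <- s) f i w)).
Proof.
move=> fi; under [X in _.-integrable _ X]eq_fun do rewrite /= -sumEFin.
by apply: integrable_sum => // i _; exact: fi.
Qed.

Lemma integrableZl_EFin (mu : {measure set T -> \bar R}) (r : R) (f : T -> R) :
  mu.-integrable setT (EFin \o f) ->
  mu.-integrable setT (EFin \o (fun w => r * f w)).
Proof.
move=> fi; under [X in _.-integrable _ X]eq_fun do rewrite /= EFinM.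
exact: integrableZl.
Qed.

Lemma integrableD_EFin (mu : {measure set T -> \bar R}) (f g : T -> R) :
  mu.-integrable setT (EFin \o f) -> mu.-integrable setT (EFin \o g) ->
  mu.-integrable setT (EFin \o (fun w => f w + g w)).
Proof.
move=> fi gi; under [X in _.-integrable _ X]eq_fun do rewrite /= EFinD.
exact: integrableD.
Qed.

Lemma Rintegral_cst1 (P : probability T R) (r : R) : \int[P]_w r = r.
Proof. by rewrite Rintegral_cst//= probability_setT mulr1. Qed.

(** Pointwise, eta |a| <= eta^2 + a^2. This stands in for the Cauchy-Schwarz inequality: a second
    moment at most eta^2 gives an L^1 norm at most 2 eta. *)
Lemma Rintegral_norm_le_sqr (P : probability T R) (f : T -> R) (eta : R) :
  0 < eta -> P.-integrable setT (EFin \o f) ->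
  P.-integrable setT (EFin \o (fun w => f w ^+ 2)) ->
  \int[P]_w `|f w| <= eta + eta^-1 * \int[P]_w (f w ^+ 2).
Proof.
move=> eta0 fi f2i.
have ci : P.-integrable setT (EFin \o (fun=> eta)).
  exact: finite_measure_integrable_cst.
have vi := integrableZl_EFin eta^-1 f2i.
rewrite -RintegralZl// -[X in X + _](Rintegral_cst1 P).
rewrite -(RintegralD measurableT ci vi).
apply: le_Rintegral => //.
- exact: integrable_norm.
- exact: integrableD_EFin.
- move=> w _; rewrite -(real_normK (num_real (f w))).
  set a := `|f w|; have a0 : 0 <= a by exact: normr_ge0.
  rewrite -(ler_pM2l eta0) mulrDr mulrA divff ?gt_eqF// mul1r.
  nra.
Qed.

Lemma Rintegral_indic (P : probability T R) (A : set T) : measurable A ->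
  \int[P]_w (\1_A w) = fine (P A).
Proof. by move=> mA; rewrite /Rintegral integral_indic// setIT. Qed.

(** Expanding the product leaves only indicators and constants; the value is the covariance of the
    two indicators. *)
Lemma Rintegral_mul_centered_indic (P : probability T R) (A B : set T) (p : R) :
  measurable A -> measurable B -> P A = p%:E -> P B = p%:E ->
  P.-integrable setT (EFin \o (fun w => (\1_A w - p) * (\1_B w - p))) /\
  \int[P]_w ((\1_A w - p) * (\1_B w - p)) = fine (P (A `&` B)) - p ^+ 2.
Proof.
move=> mA mB PA PB; have mAB := measurableI _ _ mA mB.
have iA := integrable_indic P mA; have iB := integrable_indic P mB.
have iAB := integrable_indic P mAB.
have eqf : (fun w => (\1_A w - p) * (\1_B w - p)) =
    (fun w => (\1_(A `&` B) w + p ^+ 2) + - p * (\1_A w + \1_B w)).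
  by apply/funext => w; rewrite indicI/=; ring.
have ic : P.-integrable setT (EFin \o (fun=> p ^+ 2)).
  exact: finite_measure_integrable_cst.
have i1 := integrableD_EFin iAB ic.
have i3 := integrableD_EFin iA iB.
have i2 := integrableZl_EFin (- p) i3.
rewrite eqf; split; first exact: integrableD_EFin.
rewrite (RintegralD measurableT i1 i2) (RintegralD measurableT iAB ic).
rewrite (RintegralZl _ measurableT i3) (RintegralD measurableT iA iB).
by rewrite !Rintegral_indic// Rintegral_cst1 PA PB/=; ring.
Qed.

(** The k counted lie among the 2 m + 1 integers starting at i - m, a subtraction truncated at 0. *)
Lemma sum_near_diagonal_le (n m i : nat) :
  (\sum_(k < n) ((i < k + m) && (k < i + m)) <= m.*2.+1)%N.
Proof.
rewrite -(big_mkord xpredT (fun k =>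
  nat_of_bool ((i < k + m) && (k < i + m))%N)).
rewrite -big_mkcond/= sum1_count -size_filter -(size_iota (i - m) m.*2.+1).
apply: uniq_leq_size; first by rewrite filter_uniq// iota_uniq.
by move=> k; rewrite mem_filter !mem_iota; lia.
Qed.

(* Pairs (i, k) with |i - k| < m number at most n (2 m + 1), and each
   contributes a covariance at most 1. *)
Lemma event_frequency_variance (P : probability T R) (A : nat -> set T)
    (p eps : R) (m n : nat) :
  (forall i, measurable (A i)) -> (forall i, P (A i) = p%:E) -> 0 <= eps ->
  (forall i k, (i + m <= k)%N -> fine (P (A i `&` A k)) - p ^+ 2 <= eps) ->
  (0 < n)%N ->
  let f w := n%:R^-1 * (\sum_(i < n) \1_(A i) w) - p in
  P.-integrable setT (EFin \o (fun w => f w ^+ 2)) /\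
  \int[P]_w (f w ^+ 2) <= eps + m.*2.+1%:R / n%:R.
Proof.
move=> mA PA eps0 dec n0 f.
have n0' : n%:R != 0 :> R by rewrite pnatr_eq0 -lt0n.
have prodE i k := Rintegral_mul_centered_indic (mA i) (mA k) (PA i) (PA k).
(* The square as a double sum, so that its integral becomes a sum of covariances. *)
have fE : (fun w => f w ^+ 2) = (fun w => n%:R ^- 2 *
    \sum_(i < n) \sum_(k < n) (\1_(A i) w - p) * (\1_(A k) w - p)).
  apply/funext => w; under eq_bigr do rewrite -mulr_sumr.
  rewrite -mulr_suml -expr2 -exprVn -exprMn sumrB sumr_const card_ord.
  by rewrite -mulr_natr; congr (_ ^+ 2); rewrite /f; field.
have isum i : P.-integrable setT (EFin \o (fun w =>
    \sum_(k < n) (\1_(A i) w - p) * (\1_(A k) w - p))).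
  by apply: integrable_sum_EFin => k; case: (prodE i k).
rewrite fE; split.
  by apply: integrableZl_EFin; apply: integrable_sum_EFin => i; exact: isum.
rewrite RintegralZl//; last by apply: integrable_sum_EFin => i; exact: isum.
rewrite Rintegral_sum; last by move=> i; exact: isum.
have cov i k : \int[P]_w ((\1_(A i) w - p) * (\1_(A k) w - p)) <=
    eps + ((i < k + m) && (k < i + m))%N%:R.
  rewrite (prodE i k).2.
  (* The decay hypothesis has the earlier index first; commuting the intersection covers the other
     order. *)
  have [ik|ki] := leqP (k + m) i; first by rewrite addr0 setIC dec.
  have [ik'|ki'] := leqP (i + m) k; first by rewrite addr0 dec.
  have : fine (P (A i `&` A k)) <= 1.
    have mik := measurableI _ _ (mA i) (mA k).
    by rewrite -lee_fin fineK ?fin_num_measure// probability_le1.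
  by have := sqr_ge0 p; rewrite /=; lra.
have row (i : 'I_n) : \int[P]_w
    (\sum_(k < n) (\1_(A i) w - p) * (\1_(A k) w - p)) <=
    n%:R * eps + m.*2.+1%:R.
  rewrite Rintegral_sum; last by move=> k; case: (prodE i k).
  apply: le_trans; first by apply: ler_sum => k _; exact: cov.
  rewrite big_split/= sumr_const card_ord -[eps *+ n]mulr_natl lerD2l.
  rewrite -natr_sum ler_nat.
  exact: sum_near_diagonal_le.
rewrite mulrC ler_pdivrMr ?exprn_gt0 ?ltr0n//.
apply: le_trans; first by apply: ler_sum => i _; exact: row.
rewrite sumr_const card_ord -[_ *+ n]mulr_natl.
by rewrite [leLHS](_ : _ = (eps + m.*2.+1%:R / n%:R) * n%:R ^+ 2)//; field.
Qed.

End integrals.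

(** Serves, with b = N e, to dominate |X i| by an integrable function. *)
Lemma norm_le_tail_bound {R : realFieldType} (b e x : R) : 0 <= b -> 0 <= e ->
  `|x| <= b + (e + 2 * (`|x| * (b <= `|x|)%R%:R)).
Proof.
move=> b0 e0; have [h|h] := leP b `|x|; rewrite ?mulr1 ?mulr0; lra.
Qed.

(** * Mixing and equal laws for one process *)

Section process.
Context d (T : measurableType d) (R : realType) (P : probability T R).
Variable X : nat -> {RV P >-> R}.

(** The two preimages are generators of the past up to i and of the future from i + (k - i) = k, so
    the pair is admissible in both suprema. *)
Lemma mixing_coef_preimages (B C : set R) (i k : nat) :
  measurable B -> measurable C -> (i <= k)%N ->
  (`|P ((X i @^-1` B) `&` (X k @^-1` C)) - P (X i @^-1` B) * P (X k @^-1` C)|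
    <= strong_mixing_coef X (k - i))%E.
Proof.
move=> mB mC ik; apply: (@le_trans _ _ (ereal_sup
    [set `| P (AB.1 `&` AB.2) - P AB.1 * P AB.2 |%E | AB in
        sigma_gen X [set j | (j <= i)%N] `*`
        sigma_gen X [set j | (i + (k - i) <= j)%N] ]));
  last by apply: ereal_sup_ubound; exists i.
apply: ereal_sup_ubound; exists (X i @^-1` B, X k @^-1` C) => //.
split; apply: sub_sigma_algebra.
- by exists i => //=; exists B => //; rewrite setTI.
- by exists k => /=; [rewrite subnKC|exists C => //; rewrite setTI].
Qed.

Hypothesis X_id : identically_distributed X.

Lemma preimage_id_distributed (i : nat) (B : set R) : measurable B ->
  P (X i @^-1` B) = P (X 0%N @^-1` B).
Proof. by move=> mB; exact: X_id. Qed.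

(** Both sides are integrals of g against the law of the variable, and agreement of the laws on
    Borel sets suffices. *)
Lemma ge0_integral_id_distributed (g : R -> R) (i : nat) :
  measurable_fun [set: R] g -> (forall x, 0 <= g x) ->
  (\int[P]_w (g (X i w))%:E = \int[P]_w (g (X 0%N w))%:E)%E.
Proof.
move=> mg g0.
have distE j : (\int[P]_w (g (X j w))%:E =
    \int[distribution P (X j)]_x (g x)%:E)%E.
  rewrite ge0_integral_distribution//.
  exact/measurable_EFinP.
rewrite !distE.
by apply: eq_measure_integral => A mA _; exact: X_id.
Qed.

(** * L^1 bound for the frequency of a single event, with explicit constants *)

Variables (eps : R) (m n : nat).
Hypothesis eps_ge0 : 0 <= eps.
Hypothesis coef_le : forall k, (m <= k)%N ->
  (strong_mixing_coef X k <= eps%:E)%E.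
Hypothesis n_gt0 : (0 < n)%N.

(** The variance is at most eta^2, so the L^1 norm is at most eta + eta^2 / eta. *)
Lemma preimage_frequency_L1 (B : set R) (eta : R) : measurable B -> 0 < eta ->
  eps + m.*2.+1%:R / n%:R <= eta ^+ 2 ->
  let f w := n%:R^-1 * (\sum_(i < n) \1_(X i @^-1` B) w)
             - fine (P (X 0%N @^-1` B)) in
  P.-integrable setT (EFin \o f) /\ \int[P]_w `|f w| <= eta *+ 2.
Proof.
move=> mB eta0 hn f.
have mA i : measurable (X i @^-1` B) by exact: measurable_funPTI.
have PA i : P (X i @^-1` B) = (fine (P (X 0%N @^-1` B)))%:E.
  by rewrite preimage_id_distributed// fineK// fin_num_measure.
have dec i k : (i + m <= k)%N ->
    fine (P ((X i @^-1` B) `&` (X k @^-1` B))) - fine (P (X 0%N @^-1` B)) ^+ 2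
      <= eps.
  move=> ik; have ik' : (i <= k)%N by apply: leq_trans ik; exact: leq_addr.
  have mk : (m <= k - i)%N by rewrite leq_subRL.
  (* Passes from the extended-real mixing bound to real numbers once all probabilities are known to
     be finite. *)
  have num (q r r' : \bar R) (s : R) : q \is a fin_num ->
      r = s%:E -> r' = s%:E -> (`|q - r * r'| <= eps%:E)%E ->
      fine q - s ^+ 2 <= eps.
    case: q => [q||]// _ -> ->.
    by rewrite -EFinM -EFinB lee_fin => /(le_trans (ler_norm _)); rewrite expr2.
  apply: (num _ _ _ _ _ (PA i) (PA k)).
    by apply: fin_num_measure; exact: measurableI.
  exact: le_trans (mixing_coef_preimages mB mB ik') (coef_le mk).
have [if2 var] := event_frequency_variance mA PA eps_ge0 dec n_gt0.
have fi : P.-integrable setT (EFin \o f).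
  apply: integrableD_EFin.
    apply: integrableZl_EFin; apply: integrable_sum_EFin => i.
    exact: integrable_indic.
  exact: finite_measure_integrable_cst.
split=> //; apply: le_trans (Rintegral_norm_le_sqr eta0 fi if2) _.
rewrite mulr2n lerD2l ler_pdivrMl// -expr2.
exact: le_trans var hn.
Qed.

(** * From events to the empirical mean by truncation *)

Variables (e t : R) (N : nat).
Hypothesis e_gt0 : 0 < e.
Hypothesis tail_le :
  ('E_P[fun w => (`|X 0%N w| * \1_[set v | (N%:R * e <= `|X 0%N v|)%R] w)%R]
    <= t%:E)%E.

(** The error bound of [sum_layers_error] as a function of x; its mean is at most e + 2 t. *)
Let g (x : R) : R := e + 2 * (`|x| * (N%:R * e <= `|x|)%R%:R).

Let mtail : measurable_fun [set: R]
  (fun x : R => `|x| * (N%:R * e <= `|x|)%R%:R).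
Proof.
have mnorm : measurable_fun [set: R] (fun x : R => `|x|).
  exact: normr_measurable.
apply: measurable_funM => //.
have -> : (fun x : R => (N%:R * e <= `|x|)%R%:R) =
    \1_[set x : R | N%:R * e <= `|x|] :> (R -> R).
  by apply/funext => x; rewrite indicE mem_setE.
apply: measurable_indic; rewrite -[X in measurable X]setTI.
exact: measurable_fun_le.
Qed.

Let mg : measurable_fun [set: R] g.
Proof. by apply: measurable_funD => //; apply: measurable_funM. Qed.

Let g_ge0 x : 0 <= g x.
Proof. by rewrite addr_ge0 ?(ltW e_gt0)// mulr_ge0// mulr_ge0. Qed.

Let norm_le_g x : `|x| <= N%:R * e + g x.
Proof.
by rewrite /g norm_le_tail_bound ?mulr_ge0// ltW.
Qed.

Let g0_le : (\int[P]_w (g (X 0%N w))%:E <= (e + 2 * t)%:E)%E.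
Proof.
rewrite /g; under eq_integral do rewrite EFinD EFinM.
have mh : measurable_fun setT
    (fun w => (`|X 0%N w| * (N%:R * e <= `|X 0%N w|)%R%:R)).
  by have := measurableT_comp mtail (@measurable_funPT _ _ _ _ (X 0%N)).
rewrite ge0_integralD//; last 2 first.
- by move=> w _; rewrite lee_fin ltW.
- by apply/measurable_EFinP; exact: measurable_funM.
rewrite integral_cst// [X in (_ * X + _)%E](_ : _ = 1%E); last first.
  exact: probability_setT.
rewrite mule1.
rewrite ge0_integralZl_EFin//; last exact/measurable_EFinP.
rewrite (EFinD e) (EFinM 2); apply: leeD2l; apply: lee_wpmul2l => //.
apply: le_trans tail_le; rewrite unlock.
by under [leRHS]eq_integral do rewrite indicE mem_setE.
Qed.

Let g_integrable i : P.-integrable setT (EFin \o (fun w => g (X i w))).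
Proof.
apply/integrableP; split.
  apply/measurable_EFinP.
  by have := measurableT_comp mg (@measurable_funPT _ _ _ _ (X i)).
under eq_integral do rewrite /= ger0_norm//.
rewrite ge0_integral_id_distributed//.
by apply: le_lt_trans g0_le _; rewrite ltry.
Qed.

Let Rintegral_g_le i : \int[P]_w g (X i w) <= e + 2 * t.
Proof.
rewrite -lee_fin fineK; last first.
  by apply: integrable_fin_num => //; exact: g_integrable.
by rewrite ge0_integral_id_distributed//; exact: g0_le.
Qed.

(** The finite tail bound already yields integrability, since |x| <= N e + g x. *)
Lemma integrable_of_tail i : P.-integrable setT (EFin \o X i).
Proof.
have ic : P.-integrable setT (EFin \o (fun=> N%:R * e)).
  exact: finite_measure_integrable_cst.
apply: le_integrable (integrableD_EFin ic (g_integrable i)) => //.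
  by apply/measurable_EFinP.
move=> w _; rewrite lee_fin (le_trans (norm_le_g _))//.
exact: ler_norm.
Qed.

(** Rounding costs e + 2 t twice, once in the average and once in the expectation; each of the 2 N
    layers adds e times a frequency error of at most 2 eta. *)
Lemma mean_deviation_L1 (eta : R) : 0 < eta ->
  eps + m.*2.+1%:R / n%:R <= eta ^+ 2 ->
  let D w := n%:R^-1 * (\sum_(i < n) X i w) - \int[P]_w X 0%N w in
  P.-integrable setT (EFin \o D) /\
  \int[P]_w `|D w| <= (e + 2 * t) *+ 2 + N.*2%:R * (e * (eta *+ 2)).
Proof.
move=> eta0 hn D.
have n0' : n%:R != 0 :> R by rewrite pnatr_eq0 -lt0n.
pose B j := [set x : R | j.+1%:R * e - N%:R * e <= x].
have mB j : measurable (B j).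
  have -> : B j = `[j.+1%:R * e - N%:R * e, +oo[%classic.
    by apply/seteqP; split => x; rewrite /B/= in_itv/= andbT.
  exact: measurable_itv.
have freq j := preimage_frequency_L1 (mB j) eta0 hn.
pose p j := fine (P (X 0%N @^-1` B j)).
pose f j w := n%:R^-1 * (\sum_(i < n) \1_(X i @^-1` B j) w) - p j.
(* [phi i] is [X i] truncated and rounded down to a multiple of e; [f j] is the centred frequency of
   layer j. *)
pose phi i w := \sum_(j < N.*2) e * \1_(X i @^-1` B j) w - N%:R * e.
have phi_err i w : `|X i w - phi i w| <= g (X i w).
  have := sum_layers_error (X i w) N e_gt0; congr (`|_ - (_ - _)| <= _).
  by apply: eq_bigr => j _; rewrite indicE mem_setE.
have i1 i : P.-integrable setT
    (EFin \o (fun w => \sum_(j < N.*2) e * \1_(X i @^-1` B j) w)).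
  apply: integrable_sum_EFin => j; apply: integrableZl_EFin.
  by apply: integrable_indic; exact: measurable_funPTI.
have iphi i : P.-integrable setT (EFin \o phi i).
  apply: integrableD_EFin => //; exact: finite_measure_integrable_cst.
have Ephi : \int[P]_w phi 0%N w = \sum_(j < N.*2) e * p j - N%:R * e.
  rewrite RintegralB//; last exact: finite_measure_integrable_cst.
  rewrite Rintegral_cst1 Rintegral_sum.
    congr (_ - _); apply: eq_bigr => j _; rewrite RintegralZl//.
      by rewrite Rintegral_indic//; exact: measurable_funPTI.
    by apply: integrable_indic; exact: measurable_funPTI.
  move=> j; apply: integrableZl_EFin.
  by apply: integrable_indic; exact: measurable_funPTI.
have iX := integrable_of_tail.
have iD : P.-integrable setT (EFin \o D).
  apply: integrableD_EFin; last exact: finite_measure_integrable_cst.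
  by apply: integrableZl_EFin; apply: integrable_sum_EFin.
have EX_phi : `|\int[P]_w phi 0%N w - \int[P]_w X 0%N w| <= e + 2 * t.
  rewrite distrC -RintegralB//.
  have idiff : P.-integrable setT (EFin \o (fun w => X 0%N w - phi 0%N w)).
    apply: integrableD_EFin => //.
    have := integrableZl_EFin (-1) (iphi 0%N).
    by apply: eq_integrable => // w _ /=; rewrite mulN1r.
  apply: le_trans (le_normr_Rintegral _ idiff) _ => //.
  apply: le_trans (Rintegral_g_le 0%N); apply: le_Rintegral => //.
  exact: integrable_norm.
split=> //.
(* [D] splits into the averaged rounding error, the weighted frequency errors of the layers, and the
   rounding error of the expectation. *)
have D_le w : `|D w| <= (n%:R^-1 * (\sum_(i < n) g (X i w)) +
    \sum_(j < N.*2) e * `|f j w|) + (e + 2 * t).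
  have -> : D w = n%:R^-1 * (\sum_(i < n) (X i w - phi i w)) +
      \sum_(j < N.*2) e * f j w +
      (\int[P]_w phi 0%N w - \int[P]_w X 0%N w).
    rewrite Ephi /D /f /phi !sumrB sumr_const card_ord exchange_big/=.
    have -> : \sum_(j < N.*2) e *
        (n%:R^-1 * (\sum_(i < n) \1_(X i @^-1` B j) w) - p j) =
      n%:R^-1 * (\sum_(j < N.*2) \sum_(i < n) e * \1_(X i @^-1` B j) w) -
      \sum_(j < N.*2) e * p j.
      rewrite mulr_sumr -sumrB; apply: eq_bigr => j _.
      by rewrite -mulr_sumr; ring.
    rewrite -[_ *+ n]mulr_natl; field.
    exact: n0'.
  apply: le_trans (ler_normD _ _) _; apply: lerD; last exact: EX_phi.
  apply: le_trans (ler_normD _ _) _; apply: lerD.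
    rewrite normrM ger0_norm ?invr_ge0//.
    apply: ler_wpM2l; first by rewrite invr_ge0.
    by apply: le_trans (ler_norm_sum _ _ _) _; apply: ler_sum.
  apply: le_trans (ler_norm_sum _ _ _) _; apply: ler_sum => j _.
  by rewrite normrM gtr0_norm.
have ig := integrableZl_EFin n%:R^-1
  (integrable_sum_EFin (index_enum 'I_n) (fun i : 'I_n => g_integrable i)).
have ief (j : 'I_N.*2) :
    P.-integrable setT (EFin \o (fun w => e * `|f j w|)).
  apply: integrableZl_EFin; have := integrable_norm (freq j).1.
  exact.
have isf := integrable_sum_EFin (index_enum 'I_N.*2) ief.
have igf := integrableD_EFin ig isf.
have ict : P.-integrable setT (EFin \o (fun=> e + 2 * t)).
  exact: finite_measure_integrable_cst.
apply: le_trans (le_Rintegral _ (integrable_norm iD) (integrableD_EFin igf ict)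
  (fun w _ => D_le w)) _ => //.
rewrite (RintegralD measurableT igf ict) (RintegralD measurableT ig isf).
rewrite Rintegral_cst1 (RintegralZl _ measurableT); last first.
  by apply: integrable_sum_EFin.
rewrite !Rintegral_sum//.
have S1 : n%:R^-1 * (\sum_(i < n) \int[P]_w g (X i w)) <= e + 2 * t.
  rewrite ler_pdivrMl ?ltr0n//; apply: le_trans.
    by apply: ler_sum => i _; exact: Rintegral_g_le.
  by rewrite sumr_const card_ord -[_ *+ n]mulr_natl.
have S2 : \sum_(j < N.*2) \int[P]_w (e * `|f j w|) <=
    N.*2%:R * (e * (eta *+ 2)).
  apply: (@le_trans _ _ (\sum_(j < N.*2) e * (eta *+ 2))).
    apply: ler_sum => j _; rewrite RintegralZl//.
      by apply: ler_wpM2l; [exact: ltW|exact: (freq j).2].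
    exact: integrable_norm (freq j).1.
  by rewrite sumr_const card_ord -[_ *+ N.*2]mulr_natl.
by rewrite mulr2n; lra.
Qed.

End process.

(** * Convergence to 0 in the extended reals *)

Lemma near_le_of_cvge0 {R : realType} {I : Type} (F : set_system I)
    {FF : Filter F} (u : I -> \bar R) : u x @[x --> F] --> 0%E ->
  forall r : R, 0 < r -> \forall x \near F, (u x <= r%:E)%E.
Proof.
move=> /fine_cvgP[ufin ucvg] r r0.
move/cvgrPdist_le : ucvg => /(_ r r0) H.
near=> x.
have xfin : u x \is a fin_num by near: x; exact: ufin.
rewrite -(fineK xfin) lee_fin.
have : `|0 - fine (u x)| <= r by near: x; exact: H.
by rewrite sub0r normrN => /(le_trans (ler_norm _)).
Unshelve. all: by end_near. Qed.

(** Nonnegativity makes upper bounds enough; the bound for r = 1 gives eventual finiteness. *)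
Lemma cvge0_of_near_le {R : realType} {I : Type} (F : set_system I)
    {FF : Filter F} (u : I -> \bar R) : (forall x, 0 <= u x)%E ->
  (forall r : R, 0 < r -> \forall x \near F, (u x <= r%:E)%E) ->
  u x @[x --> F] --> 0%E.
Proof.
move=> u0 ur; have fin x (r : R) : (u x <= r%:E)%E -> u x \is a fin_num.
  by move=> h; rewrite ge0_fin_numE// (le_lt_trans h)// ltry.
apply/fine_cvgP; split.
  by near=> x; apply: (fin _ 1); near: x; exact: ur.
apply/cvgrPdist_le => r r0; near=> x.
have xr : (u x <= r%:E)%E by near: x; exact: ur.
rewrite sub0r normrN ger0_norm ?fine_ge0//.
by rewrite -lee_fin fineK// (fin _ r).
Unshelve. all: by end_near. Qed.

(** * The uniform weak law: choice of constants and Markov's inequality *)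

Local Open Scope ereal_scope.

Theorem corollaryA2 (R : realType) (Pi : Type) (Pi_neq0 : inhabited Pi)
    (d : Pi -> measure_display) (Omega : forall pi : Pi, measurableType (d pi))
    (P : forall pi : Pi, probability (Omega pi) R)
    (xi : forall pi : Pi, nat -> {RV (P pi) >-> R})
    (xi_id : forall pi : Pi, identically_distributed (xi pi))
    (xi_mixing : forall pi : Pi, strongly_mixing (xi pi))
    (xi_ui : ereal_sup [set 'E_(P pi)[fun w : Omega pi =>
                 (`|xi pi 0%N w| * \1_[set v | K <= `|xi pi 0%N v|] w)%R]
               | pi in [set: Pi]] @[K --> +oo%R] --> 0)
    (xi_unif_mixing : ereal_sup [set strong_mixing_coef (xi pi) n
               | pi in [set: Pi]] @[n --> \oo] --> 0)
    (delta : R) (delta_gt0 : (0 < delta)%R) :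
  ereal_sup [set P pi [set w : Omega pi | delta%:E <=
      `| (n%:R^-1 * \sum_(i < n) xi pi i w)%:E - 'E_(P pi)[xi pi 0%N] | ]
    | pi in [set: Pi]] @[n --> \oo] --> 0.
Proof.
apply: cvge0_of_near_le => [n|r r0].
  (* The supremum over an empty index set would be -oo. *)
  case: Pi_neq0 => pi; apply: le_trans (ereal_sup_ubound _); last by exists pi.
  exact: measure_ge0.
(* By Markov's inequality an L^1 deviation of at most q suffices. The choices of e and t make 2 (e +
   2 t) = q / 3. The constants e, t, N, eta, eps, m are fixed in this order, none depending on an
   index pi. *)
pose q := (delta * r)%R; have q0 : (0 < q)%R by rewrite mulr_gt0.
pose e := (q / 12)%R; have e0 : (0 < e)%R by rewrite divr_gt0.
pose t := (q / 24)%R; have t0 : (0 < t)%R by rewrite divr_gt0.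
have [M [_ tail]] := near_le_of_cvge0 xi_ui t0.
(* The truncation level must be a multiple of e strictly beyond M. *)
have [N MN] : exists N, (M < N%:R * e)%R.
  exists (Num.truncn (M / e)).+1; rewrite -ltr_pdivrMr//; exact: truncnS_gt.
pose c := (N.*2%:R * (e * 2))%R.
have c0 : (0 <= c)%R by rewrite mulr_ge0// mulr_ge0// ltW.
(* Makes the layer term c eta at most q / 3; adding 1 keeps the denominator positive when only c >=
   0 is known. *)
pose eta := (q / 3 / (c + 1))%R.
have eta0 : (0 < eta)%R by rewrite !divr_gt0// ltr_wpDl.
(* Half of the variance budget eta^2; the other half bounds (2 m + 1) / n for large n. *)
pose eps := (eta ^+ 2 / 2)%R.
have eps0 : (0 < eps)%R by rewrite divr_gt0// exprn_gt0.
have [m _ mix] := near_le_of_cvge0 xi_unif_mixing eps0.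
exists (Num.truncn (m.*2.+1%:R / eps)).+1 => // n /= hn.
have n0 : (0 < n)%N by apply: leq_trans hn.
have hneta : (eps + m.*2.+1%:R / n%:R <= eta ^+ 2)%R.
  have : (m.*2.+1%:R / n%:R <= eps)%R.
    rewrite ler_pdivrMr ?ltr0n// mulrC -ler_pdivrMr//.
    apply: le_trans (ltW (truncnS_gt _)) _; by rewrite ler_nat.
  by rewrite /eps; lra.
apply: ge_ereal_sup => _ [pi _ <-].
have coef_le k : (m <= k)%N -> strong_mixing_coef (xi pi) k <= eps%:E.
  move=> mk; apply: le_trans (mix _ mk); apply: ereal_sup_ubound.
  by exists pi.
have tail_le : 'E_(P pi)[fun w => (`|xi pi 0%N w| *
    \1_[set v | (N%:R * e <= `|xi pi 0%N v|)%R] w)%R] <= t%:E.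
  by apply: le_trans (tail _ MN); apply: ereal_sup_ubound; exists pi.
have [iD D_le] := mean_deviation_L1 (xi_id pi) (ltW eps0) coef_le n0 e0 tail_le
  eta0 hneta.
have iX0 := integrable_of_tail (xi_id pi) e0 tail_le 0%N.
(* Integrability makes the mean finite, so the extended-real expectation is the real integral. *)
have E0 : 'E_(P pi)[xi pi 0%N] = (\int[P pi]_w xi pi 0%N w)%R%:E.
  by rewrite unlock /Rintegral fineK//; apply: integrable_fin_num.
rewrite E0.
have := le_integral_abse (P pi) measurableT (measurable_int _ iD) delta_gt0.
rewrite setTI => markov.
(* Multiplying the goal by delta matches Markov's inequality without a division. *)
rewrite -(@lee_pmul2l _ delta%:E)// -EFinM -/q.
apply: le_trans markov _.
have Dfin := integrable_fin_num measurableT (integrable_norm iD).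
rewrite -lee_fin /Rintegral fineK// in D_le.
apply: le_trans D_le _; rewrite lee_fin.
have : (c * eta <= q / 3)%R.
  rewrite /eta mulrCA ger_pMr ?divr_gt0// ler_pdivrMr ?ltr_wpDl// mul1r.
  by rewrite lerDl.
by rewrite /c /e /t; lra.
Qed.
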